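(* $\mathrm{dc}_+(3) \geq 7$ and $\mathrm{dc}(4) \geq 12$. That is: in a free semigroup $A^+$ there exists a decreasing chain of $7$ equations over $3$ unknowns, and in a free monoid $A^*$ there exists a decreasing chain of $12$ equations over $4$ unknowns.
   Context: $A$ is an alphabet with at least two letters. For a set $\Xi$ of $n$ variables, an equation in the free semigroup $A^+$ is a pair $U=V$ with $U,V\in\Xi^+$, and a solution is a morphism $h:\Xi^+\to A^+$ with $h(U)=h(V)$; in the free monoid $A^*$ equations are pairs $U=V$ with $U,V\in\Xi^*$ and solutions are morphisms $h:\Xi^*\to A^*$ with $h(U)=h(V)$. A morphism solves a system if it solves each equation (every morphism solves the empty system); systems are equivalent if they have the same solutions. A finite sequence $E_1,\dots,E_m$ of equations is a decreasing chain if for every $i\in\{0,\dots,m-1\}$ the system $E_1,\dots,E_i$ is not equivalent to $E_1,\dots,E_{i+1}$. $\mathrm{dc}(n)$ (resp. $\mathrm{dc}_+(n)$) is the maximal length of a decreasing chain over $n$ unknowns in the free monoid (resp. free semigroup). *)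

(* Defs.v *)
From HB Require Import structures.
From mathcomp Require Import all_boot.
From mathcomp Require Import boolp.

Set Implicit Arguments.
Unset Strict Implicit.
Unset Printing Implicit Defensive.


Definition free_monoid (T : Type) := seq T.

HB.instance Definition _ (T : choiceType) := Choice.on (free_monoid T).
HB.instance Definition _ (T : choiceType) :=
  isSemigroup.Build (free_monoid T) (@catA T).
HB.instance Definition _ (T : choiceType) :=
  Semigroup_isMonoid.Build (free_monoid T) (@cat0s T) (@cats0 T).

Definition free_semigroup (T : choiceType) := {w : seq T | w != [::]}.

Lemma cat_neq_nil (T : choiceType) (u v : free_semigroup T) :
  val u ++ val v != [::].
Proof. by case: u => -[]. Qed.

Definition free_semigroup_mul (T : choiceType) (u v : free_semigroup T) :
  free_semigroup T := exist _ (val u ++ val v) (cat_neq_nil u v).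

Lemma free_semigroup_mulA (T : choiceType) :
  associative (@free_semigroup_mul T).
Proof. by move=> u v w; apply: val_inj; rewrite /= catA. Qed.

HB.instance Definition _ (T : choiceType) := Choice.on (free_semigroup T).
HB.instance Definition _ (T : choiceType) :=
  isSemigroup.Build (free_semigroup T) (@free_semigroup_mulA T).

Definition equation (X : eqType) : eqType := (X * X)%type.

(* X is the structure generated by the unknowns, Y the target structure, and H
   the type of morphisms from X to Y, applied through app. *)
Section Chains.
Variables (X : eqType) (Y H : Type) (app : H -> X -> Y).

Definition solves (h : H) (e : equation X) : Prop := app h e.1 = app h e.2.

Definition solves_system (h : H) (s : seq (equation X)) : Prop :=
  forall e, e \in s -> solves h e.

Definition equivalent (s t : seq (equation X)) : Prop :=
  forall h, solves_system h s <-> solves_system h t.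

Definition decreasing_chain (s : seq (equation X)) : Prop :=
  forall i : nat, i < size s -> ~ equivalent (take i s) (take i.+1 s).

Definition is_max_chain_length (m : nat) : Prop :=
  (exists2 s, decreasing_chain s & size s = m) /\
  (forall s, decreasing_chain s -> size s <= m).

(* None stands for infinity: the empty chain is decreasing, so there is no
   maximal length exactly when the lengths are unbounded. *)
Definition max_chain_length : option nat :=
  if pselect (exists m, is_max_chain_length m) is left ex
  then Some (sval (cid ex)) else None.

End Chains.

Definition leq_ext (k : nat) (d : option nat) : bool :=
  if d is Some m then k <= m else true.

Section Words.
Variables (A : choiceType) (n : nat).

Definition semigroup_hom :=
  {multiplicative free_semigroup 'I_n -> free_semigroup A}.

Definition monoid_hom :=
  UMagmaMorphism.type (free_monoid 'I_n) (free_monoid A).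

Definition semigroup_chain :=
  decreasing_chain
    (fun (h : semigroup_hom) (u : free_semigroup 'I_n) => h u).

Definition monoid_chain :=
  decreasing_chain (fun (h : monoid_hom) (u : free_monoid 'I_n) => h u).

Definition dc_plus : option nat :=
  max_chain_length
    (fun (h : semigroup_hom) (u : free_semigroup 'I_n) => h u).

Definition dc : option nat :=
  max_chain_length (fun (h : monoid_hom) (u : free_monoid 'I_n) => h u).

End Words.

Arguments semigroup_chain : clear implicits.
Arguments monoid_chain : clear implicits.

(* Main.v *)
(** A chain E_1, ..., E_m is certified by morphisms h_1, ..., h_m such that h_i
    solves E_j for all j < i but not E_i.

    Over three unknowns, xzxy = yzxx, xzxxzyy = yzyxzxx and xzy = yzx are
    balanced and hold whenever x = y, so they leave nonperiodic common
    solutions. Then xz = zx is still solved by all the periodic morphisms, on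
    which x = y, x = z and xx = x act as independent linear conditions.

    In the free monoid a fourth unknown t allows four more equations. Put
    T = xyz and take Tt = tT, then an equation which, when T and t <> 1 are
    powers of a word that does not commute with x, holds exactly for t = T, then
    xyt = txy and xt = tx. All four are trivial for t = 1, so the first four
    equations of the previous chain can be appended, with t = 1 in their
    witnesses; finally each unknown is set to 1 in turn. *)

Require Import Defs.
From HB Require Import structures.
From mathcomp Require Import all_boot.
From mathcomp Require Import boolp.

Set Implicit Arguments.
Unset Strict Implicit.
Unset Printing Implicit Defensive.

(** * Chains certified by separating morphisms, and the passage to the maximal length *)

Section ChainCriteria.
Variables (X : eqType) (Y H : Type) (app : H -> X -> Y).

Lemma triangular_decreasing_chain (s : seq (equation X)) (e0 : equation X) :
  (forall i, i < size s -> exists2 h : H,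
     forall j, j < i -> solves app h (nth e0 s j) & ~ solves app h (nth e0 s i)) ->
  decreasing_chain app s.
Proof.
move=> witness i lt_i_s equiv_i; have [h h_lt h_i] := witness i lt_i_s.
apply: h_i; have [+ _] := equiv_i h; apply.
  move=> _ /(nthP e0)[j + <-].
  rewrite size_takel ?(ltnW lt_i_s)// => lt_j_i.
  by rewrite nth_take//; apply: h_lt.
by rewrite (take_nth e0)// mem_rcons mem_head.
Qed.

(** When no maximal length exists the value is [None] and the bound is trivial; otherwise it is the
    maximality clause. *)
Lemma chain_leq_max_length (s : seq (equation X)) :
  decreasing_chain app s -> leq_ext (size s) (max_chain_length app).
Proof.
rewrite /max_chain_length => chain_s; case: pselect => //= ex.
by case: cid => m /= [_]; apply.
Qed.

End ChainCriteria.

(** * Morphisms given by words over two letters *)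

Section Substitutions.
Variables (A : choiceType) (a b : A).
Hypothesis neq_ab : a <> b.

(** Witnesses are words over [bool], where equality computes; injectivity of this embedding makes a
    failed equation fail over [A] too. *)
Definition letter (c : bool) : A := if c then a else b.

Lemma letter_inj : injective letter.
Proof. by move=> [] [] //= eq_ab; case: neq_ab. Qed.

Definition subst n (ws : seq (seq bool)) (u : seq 'I_n) : seq bool :=
  flatten [seq nth [::] ws (val i) | i <- u].

Lemma subst_cat n ws (u v : seq 'I_n) :
  subst ws (u ++ v) = subst ws u ++ subst ws v.
Proof. by rewrite /subst map_cat flatten_cat. Qed.

Lemma subst_neq_nil n ws (u : seq 'I_n) :
  n <= size ws -> [::] \notin ws -> u != [::] -> subst ws u != [::].
Proof.
case: u => [//|i u] le_n_ws ws_nonempty _.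
(* The length bound excludes the default [[::]], so the first letter already has a nonempty
   image. *)
have : nth [::] ws (val i) \in ws by rewrite mem_nth// (leq_trans (ltn_ord i)).
rewrite /subst /=; case: (nth _ _ _) => //.
by rewrite (negPf ws_nonempty).
Qed.

Definition solvesb n ws (u v : seq 'I_n) : bool := subst ws u == subst ws v.

Section MonoidSubstitution.
Variables (n : nat) (ws : seq (seq bool)).

Definition monoid_subst (u : free_monoid 'I_n) : free_monoid A :=
  map letter (subst ws u).

Fact monoid_subst_is_morphism : monoid_morphism monoid_subst.
Proof. by split=> // u v; rewrite /monoid_subst subst_cat map_cat. Qed.

HB.instance Definition _ :=
  isUMagmaMorphism.Build (free_monoid 'I_n) (free_monoid A) monoid_subst
    monoid_subst_is_morphism.

Definition monoid_subst_hom : monoid_hom A n := monoid_subst.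

Lemma solves_monoid_subst (e : equation (free_monoid 'I_n)) :
  solves (fun (h : monoid_hom A n) (u : free_monoid 'I_n) => h u)
    monoid_subst_hom e
  <-> solvesb ws e.1 e.2.
Proof.
by split=> [/(inj_map letter_inj)/eqP|/eqP subst_e] //; congr map.
Qed.

End MonoidSubstitution.

Section SemigroupSubstitution.
Variables (n : nat) (ws : seq (seq bool)).
Hypotheses (le_n_ws : n <= size ws) (ws_nonempty : [::] \notin ws).

Fact semigroup_subst_proof (u : free_semigroup 'I_n) :
  map letter (subst ws (val u)) != [::].
Proof.
by have := subst_neq_nil le_n_ws ws_nonempty (valP u); case: (subst _ _).
Qed.

Definition semigroup_subst (u : free_semigroup 'I_n) : free_semigroup A :=
  exist _ (map letter (subst ws (val u))) (semigroup_subst_proof u).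

Fact semigroup_subst_is_multiplicative :
  {morph semigroup_subst : u v / (u * v)%g >-> (u * v)%g}.
Proof. by move=> u v; apply: val_inj; rewrite /= subst_cat map_cat. Qed.

HB.instance Definition _ :=
  isMultiplicative.Build (free_semigroup 'I_n) (free_semigroup A)
    semigroup_subst semigroup_subst_is_multiplicative.

Definition semigroup_subst_hom : semigroup_hom A n := semigroup_subst.

Lemma solves_semigroup_subst (e : equation (free_semigroup 'I_n)) :
  solves (fun (h : semigroup_hom A n) (u : free_semigroup 'I_n) => h u)
    semigroup_subst_hom e
  <-> solvesb ws (val e.1) (val e.2).
Proof.
split=> [/(congr1 val)/(inj_map letter_inj)/eqP //|/eqP subst_e].
by apply: val_inj; congr map.
Qed.

End SemigroupSubstitution.

(** A boolean form of the certificate, so that a concrete chain is settled by evaluation. *)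
Definition triangular n (es : seq (seq 'I_n * seq 'I_n))
    (wss : seq (seq (seq bool))) : bool :=
  all (fun i => let ws := nth [::] wss i in
    all (fun j => let e := nth ([::], [::]) es j in solvesb ws e.1 e.2)
      (iota 0 i)
    && (let e := nth ([::], [::]) es i in ~~ solvesb ws e.1 e.2))
  (iota 0 (size es)).

Lemma triangularP n es wss i : @triangular n es wss -> i < size es ->
  let e := nth ([::], [::]) es in
  (forall j, j < i -> solvesb (nth [::] wss i) (e j).1 (e j).2)
  /\ ~~ solvesb (nth [::] wss i) (e i).1 (e i).2.
Proof.
move=> /allP tri lt_i_es.
have /tri/andP[/allP lt_i i_unsolved] : i \in iota 0 (size es).
  by rewrite mem_iota.
by split=> // j lt_j_i; apply: lt_i; rewrite mem_iota.
Qed.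

Lemma triangular_monoid_chain n (es : seq (equation (free_monoid 'I_n))) wss :
  triangular es wss -> monoid_chain A n es.
Proof.
move=> tri; apply: (@triangular_decreasing_chain _ _ _ _ _ ([::], [::])).
move=> i /(triangularP tri)[solved unsolved].
exists (monoid_subst_hom n (nth [::] wss i)).
  by move=> j /solved /solves_monoid_subst.
by move=> /solves_monoid_subst; apply/negP.
Qed.

Lemma triangular_semigroup_chain n
    (es : seq (equation (free_semigroup 'I_n))) wss :
  size es = size wss ->
  all (fun ws => (n <= size ws) && ([::] \notin ws)) wss ->
  triangular [seq (val e.1, val e.2) | e <- es] wss ->
  semigroup_chain A n es.
Proof.
(* A pair of empty words is not an equation of the free semigroup, so the head serves as the default
   for [nth]. *)
case: es => [//|e0 es'] sz /allP nonempty tri; set es := e0 :: es' in sz tri *.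
apply: (@triangular_decreasing_chain _ _ _ _ _ e0) => i lt_i_es.
(* Equal lengths keep [i] inside [wss]; the check on rows does not cover the default row. *)
have /nonempty/andP[le_n_ws ws_nonempty] : nth [::] wss i \in wss.
  by rewrite mem_nth// -sz.
have := triangularP tri; rewrite size_map => /(_ _ lt_i_es)[solved unsolved].
exists (semigroup_subst_hom le_n_ws ws_nonempty).
  move=> j lt_j_i; have := solved j lt_j_i.
  rewrite (nth_map e0) ?(ltn_trans lt_j_i)// => solved_j.
  exact/solves_semigroup_subst.
move: unsolved; rewrite (nth_map e0)// => /negP unsolved.
by move=> /solves_semigroup_subst.
Qed.

End Substitutions.

(** * The chain in the free semigroup *)

Section SevenEquations.

Let x : 'I_3 := @Ordinal 3 0 isT.
Let y : 'I_3 := @Ordinal 3 1 isT.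
Let z : 'I_3 := @Ordinal 3 2 isT.
Let a := true.
Let b := false.

Let word (u : seq 'I_3) (u_neq0 : u != [::]) : free_semigroup 'I_3 :=
  exist _ u u_neq0.

Definition semigroup_equations : seq (equation (free_semigroup 'I_3)) :=
  [:: (@word [:: x; z; x; y] isT, @word [:: y; z; x; x] isT);
      (@word [:: x; z; x; x; z; y; y] isT, @word [:: y; z; y; x; z; x; x] isT);
      (@word [:: x; z; y] isT, @word [:: y; z; x] isT);
      (@word [:: x; z] isT, @word [:: z; x] isT);
      (@word [:: x] isT, @word [:: y] isT);
      (@word [:: x] isT, @word [:: z] isT);
      (@word [:: x; x] isT, @word [:: x] isT)].

(** Each row lists the images of [x], [y], [z]. The second has y = xvxx and z = vxxv with v = b, and
    both sides of the first equation become (xvx)^3 x. The third has y = xzxx: the first equation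
    becomes xzxxzxx on both sides, the second yzyy. The last three rows are periodic. *)
Definition semigroup_witnesses : seq (seq (seq bool)) :=
  [:: [:: [:: a]; [:: b]; [:: a]];
      [:: [:: a]; [:: a; b; a; a]; [:: b; a; a; b]];
      [:: [:: a]; [:: a; b; a; a]; [:: b]];
      [:: [:: a]; [:: a]; [:: b]];
      [:: [:: a]; [:: a; a]; [:: a]];
      [:: [:: a]; [:: a]; [:: a; a]];
      [:: [:: a]; [:: a]; [:: a]]].

Lemma semigroup_equations_chain (A : choiceType) (c d : A) :
  c <> d -> semigroup_chain A 3 semigroup_equations.
Proof.
by move=> neq_cd;
  apply: (triangular_semigroup_chain neq_cd (wss := semigroup_witnesses)).
Qed.

End SevenEquations.

(** * The chain in the free monoid *)

Section TwelveEquations.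

Let x : 'I_4 := @Ordinal 4 0 isT.
Let y : 'I_4 := @Ordinal 4 1 isT.
Let z : 'I_4 := @Ordinal 4 2 isT.
Let t : 'I_4 := @Ordinal 4 3 isT.
Let a := true.
Let b := false.

(** With T = xyz the second equation reads T(xtyz)t = t(xtyz)T, which is trivial for t = T. *)
Definition monoid_equations : seq (equation (free_monoid 'I_4)) :=
  [:: ([:: x; y; z; t], [:: t; x; y; z]);
      ([:: x; y; z; x; t; y; z; t], [:: t; x; t; y; z; x; y; z]);
      ([:: x; y; t], [:: t; x; y]);
      ([:: x; t], [:: t; x]);
      ([:: x; z; x; y], [:: y; z; x; x]);
      ([:: x; z; x; x; z; y; y], [:: y; z; y; x; z; x; x]);
      ([:: x; z; y], [:: y; z; x]);
      ([:: x; z], [:: z; x]);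
      ([:: x], [::]);
      ([:: y], [::]);
      ([:: z], [::]);
      ([:: t], [::])].

(** The second row has t = TT, the next two t = T; in the fourth, z = 1 gives t = xy and so the
    third equation. Rows five to eight extend the first four of [semigroup_witnesses] by t = 1. Each
    later row has a single nonempty image, so it solves all eight balanced equations. *)
Definition monoid_witnesses : seq (seq (seq bool)) :=
  [:: [:: [:: a]; [::]; [::]; [:: b]];
      [:: [:: a]; [:: b]; [::]; [:: a; b; a; b]];
      [:: [:: a]; [:: b]; [:: a]; [:: a; b; a]];
      [:: [:: a]; [:: b]; [::]; [:: a; b]];
      [:: [:: a]; [:: b]; [:: a]; [::]];
      [:: [:: a]; [:: a; b; a; a]; [:: b; a; a; b]; [::]];
      [:: [:: a]; [:: a; b; a; a]; [:: b]; [::]];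
      [:: [:: a]; [:: a]; [:: b]; [::]];
      [:: [:: a]; [::]; [::]; [::]];
      [:: [::]; [:: a]; [::]; [::]];
      [:: [::]; [::]; [:: a]; [::]];
      [:: [::]; [::]; [::]; [:: a]]].

Lemma monoid_equations_chain (A : choiceType) (c d : A) :
  c <> d -> monoid_chain A 4 monoid_equations.
Proof.
by move=> neq_cd;
  apply: (triangular_monoid_chain neq_cd (wss := monoid_witnesses)).
Qed.

End TwelveEquations.

Theorem theorem4 (A : choiceType) (hA : exists a b : A, a <> b) :
  [/\ leq_ext 7 (dc_plus A 3),
      leq_ext 12 (dc A 4),
      exists2 s : seq (equation (free_semigroup 'I_3)),
        size s = 7 & semigroup_chain A 3 s
    & exists2 s : seq (equation (free_monoid 'I_4)),
        size s = 12 & monoid_chain A 4 s].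
Proof.
have [a [b neq_ab]] := hA.
have chain7 := semigroup_equations_chain neq_ab.
have chain12 := monoid_equations_chain neq_ab.
split; first exact: (chain_leq_max_length chain7).
- exact: (chain_leq_max_length chain12).
- by exists semigroup_equations.
- by exists monoid_equations.
Qed.
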